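(* Let $G=S_\infty$, the group of all permutations of $\omega$ with the topology of pointwise convergence. There are two minimal subflows $M\neq N$ of $S(G)$ such that $J(M)\cup J(N)$ is a subsemigroup of $S(G)$.
   Context: $S(G)$ is the Samuel compactification of $G$ with respect to its left uniformity; it is a $G$-flow (compact Hausdorff space with continuous right $G$-action) and the greatest $G$-ambit with distinguished point $1_G$. It is a compact left-topological semigroup: for $x\in S(G)$, $\lambda_x$ is the unique continuous $G$-equivariant map $S(G)\to\overline{xG}$ with $\lambda_x(1_G)=x$, and $xy:=\lambda_x(y)$. A subflow is a nonempty closed $G$-invariant subset; minimal if it contains no proper subflow. For $Y\subseteq S(G)$, $J(Y)$ is the set of idempotents $u\in Y$, i.e. $uu=u$. *)

(* Defs.v *)
From mathcomp Require Import all_boot all_order.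
From mathcomp Require Import all_classical topology.
Set Implicit Arguments. Unset Strict Implicit. Unset Printing Implicit Defensive.
Local Open Scope classical_set_scope.

Definition Sinf := {f : nat -> nat | bijective f}.

Lemma Sinf_id_bij : bijective (@id nat).
Proof. by exists id. Qed.

Lemma Sinf_comp_bij (f g : nat -> nat) :
  bijective f -> bijective g -> bijective (f \o g).
Proof.
move=> [f' fK f'K] [g' gK g'K]; exists (g' \o f') => x /=.
  by rewrite fK gK. by rewrite g'K f'K.
Qed.

Definition Sinf_one : Sinf := exist _ id Sinf_id_bij.
Definition Sinf_mul (g h : Sinf) : Sinf :=
  exist _ (sval g \o sval h) (Sinf_comp_bij (svalP g) (svalP h)).

Section Flows.
Variable X : topologicalType.
Variable a : X -> Sinf -> X.

Definition right_action :=
  (forall x, a x Sinf_one = x) /\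
  (forall x g h, a (a x g) h = a x (Sinf_mul g h)).

(* joint continuity of X x S_infty -> X, where a basic neighbourhood of g in
   S_infty is {h | h agrees with g on a finite set F} *)
Definition action_continuous :=
  forall (x : X) (g : Sinf) (W : set X), nbhs (a x g) W ->
    exists V : set X, nbhs x V /\
      exists F : seq nat, forall (y : X) (h : Sinf), V y ->
        (forall n, n \in F -> sval h n = sval g n) -> W (a y h).

Definition is_flow :=
  compact [set: X] /\ hausdorff_space X /\ right_action /\ action_continuous.

Definition is_ambit (x0 : X) :=
  is_flow /\ closure (range (a x0)) = [set: X].

Definition subflow (M : set X) :=
  M !=set0 /\ closed M /\ (forall x g, M x -> M (a x g)).

Definition minimal_subflow (M : set X) :=
  subflow M /\ (forall M' : set X, subflow M' -> M' `<=` M -> M' = M).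
End Flows.

Definition equivariant (X Y : topologicalType) (a : X -> Sinf -> X)
  (b : Y -> Sinf -> Y) (f : X -> Y) := forall x g, f (a x g) = b (f x) g.

Definition greatest_ambit (X : topologicalType) (a : X -> Sinf -> X) (x0 : X) :=
  is_ambit a x0 /\
  forall (Y : topologicalType) (b : Y -> Sinf -> Y) (y0 : Y), is_ambit b y0 ->
    exists f : X -> Y, continuous f /\ equivariant a b f /\ f x0 = y0.

(* lambda_x : the continuous G-map S(G) -> S(G) with lambda_x (x0) = x
   (unique by density of the orbit of x0 and Hausdorffness) *)
Definition lambda_map (X : topologicalType) (a : X -> Sinf -> X) (x0 x : X)
  (f : X -> X) := continuous f /\ equivariant a a f /\ f x0 = x.

Definition sg_prod (X : topologicalType) (a : X -> Sinf -> X) (x0 x y z : X) :=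
  exists f, lambda_map a x0 x f /\ f y = z.

Definition idempotents (X : topologicalType) (a : X -> Sinf -> X) (x0 : X)
  (Y : set X) : set X := [set u | Y u /\ sg_prod a x0 u u u].

Definition subsemigroup (X : topologicalType) (a : X -> Sinf -> X) (x0 : X)
  (S : set X) :=
  forall u v, S u -> S v -> exists z, S z /\ sg_prod a x0 u v z.

(* Main.v *)
Require Import Defs.
From mathcomp Require Import all_boot all_order.
From mathcomp Require Import all_classical topology.

(** The greatest ambit S(G) of G = S_infty is the inverse limit of the spaces of
    ultrafilters on the sets of injective n-tuples of naturals, so its points
    are separated by the G-maps x |-> Phi_c(x) into the flow of 2-colourings c
    of finite sequences. A coherent family T of ultrafilters on the increasing
    n-tuples yields a minimal subflow M_T, isomorphic to the flow of linear
    orders of the naturals. For u in M_T and v in M_T', the order attached to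
    uv in M_T is the order of v, or its reverse, according to whether T'-generic
    pairs are increasing or decreasing in the order of u; u is idempotent iff
    T-generic pairs are increasing in the order of u. Hence J(M_T) and J(M_T')
    together form a semigroup as soon as T and T' agree on all relations
    { (w0, w1) | w0 < w1 in some linear order }. This holds for the two families
    built from a free ultrafilter on the naturals and generic coded pairs
    (a_1, b_1), ..., (a_n, b_n), with a_1 < b_1 < a_2 < b_2 < ... in the first
    and a_1 < ... < a_n < b_1 < ... < b_n in the second, although these two
    families are different. *)

Set Implicit Arguments.
Unset Strict Implicit.
Unset Printing Implicit Defensive.
Local Open Scope classical_set_scope.

(** * Orbit closures and maps out of the greatest ambit *)

Section Density.
Context {X : topologicalType} (a : X -> Sinf -> X) (x0 : X).
Hypothesis ax0 : is_ambit a x0.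

Lemma orbit_dense (x : X) (A : set X) : nbhs x A -> exists g, A (a x0 g).
Proof.
move=> xA; have : closure (range (a x0)) x by rewrite ax0.2.
by move=> /(_ _ xA) [_ [[g _ <-] ?]]; exists g.
Qed.

Lemma orbit_closed (A : set X) :
  closed A -> (forall g, A (a x0 g)) -> forall x, A x.
Proof.
move=> clA Ag x; apply: clA => B /orbit_dense[g Bg].
by exists (a x0 g).
Qed.

Lemma orbit_ext (Z : topologicalType) (f f' : X -> Z) :
  hausdorff_space Z -> continuous f -> continuous f' ->
  (forall g, f (a x0 g) = f' (a x0 g)) -> f =1 f'.
Proof.
move=> hZ cf cf' eff' x; apply: hZ => A B fA fB.
have : nbhs x (f @^-1` A `&` f' @^-1` B).
  by apply: filterI; [exact: cf|exact: cf'].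
by move=> /orbit_dense[g [/= Ag Bg]]; exists (f (a x0 g)); split; rewrite // eff'.
Qed.

End Density.

Section OrbitClosure.
Context {Z : topologicalType} (b : Z -> Sinf -> Z) (z : Z).
Hypothesis flowb : is_flow b.

Let A : set Z := closure (range (b z)).

Lemma orbit_closure_stable (y : Z) (g : Sinf) : A y -> A (b y g).
Proof.
have [_ [_ [[_ bM] bC]]] := flowb.
move=> Ay W /bC[V [yV [F VF]]].
have [_ [[h _ <-] Vh]] := Ay _ yV.
exists (b z (Sinf_mul h g)); split; first by exists (Sinf_mul h g).
by rewrite -bM; exact: VF.
Qed.

Definition orbit_closure_act (y : A) (g : Sinf) : A :=
  exist _ (b (set_val y) g) (mem_set (@orbit_closure_stable _ g (set_valP y))).

Let base_in : A z.
Proof.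
have [_ [_ [[b1 _] _]]] := flowb.
by apply: subset_closure; exists Sinf_one; rewrite ?b1.
Qed.

Definition orbit_closure_base : A := exist _ z (mem_set base_in).

Let val_cont : continuous (set_val : A -> Z).
Proof. exact: initial_continuous. Qed.

Let nbhs_valP (y : A) (W : set A) :
  nbhs y W <-> exists2 V, nbhs (set_val y) V & set_val @^-1` V `<=` W.
Proof.
split=> [|[V yV VW]]; last by apply: filterS VW _; exact: val_cont.
rewrite nbhsE => -[B [[C oC <-] Cy] BW]; exists C => //.
by exists C.
Qed.

Lemma orbit_closure_ambit : is_ambit orbit_closure_act orbit_closure_base.
Proof.
have [cZ [hZ [[b1 bM] bC]]] := flowb.
have val_inj (y y' : A) : set_val y = set_val y' -> y = y'.
  exact: val_inj.
have cA : compact A.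
  by apply: subclosed_compact cZ _ => //; exact: closed_closure.
split; first (split; [|split; [|split; [split|]]]).
- move=> F PF _.
  have [|p [Ap clp]] := cA (set_val @ F) _ _.
    by apply: (@filterS _ F _ setT) filterT => y _; exact: set_valP.
  exists (exist _ p (mem_set Ap)); split=> // B C FB /nbhs_valP[V pV VC].
  have FI : (set_val @ F) (set_val @` B).
    by apply: (@filterS _ F _ B) FB => y By /=; exists y.
  have [_ [[y By <-] Vy]] := clp _ _ FI pV.
  by exists y; split=> //; exact: VC.
- move=> p q pq; apply: val_inj; apply: hZ => B C pB qC.
  have [y [By Cy]] := pq _ _ (val_cont pB) (val_cont qC).
  by exists (set_val y).
- by move=> y; apply: val_inj; exact: b1.
- by move=> y g h; apply: val_inj; exact: bM.
- move=> y g W /nbhs_valP[V yV VW].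
  have [U [yU [F UF]]] := bC _ _ _ yV.
  exists (set_val @^-1` U); split; first exact: val_cont.
  by exists F => y' h Uy' hF; apply: VW; exact: UF.
- rewrite -subTset => y _ W /nbhs_valP[V yV VW].
  have [_ [[h _ <-] Vh]] := set_valP y _ yV.
  exists (orbit_closure_act orbit_closure_base h); split; first by exists h.
  exact: VW.
Qed.

End OrbitClosure.

(** The universal property concerns ambits only, so it is applied to the closure of the orbit of [z]
    and followed by the inclusion into [Z]. *)
Lemma greatest_ambit_map (X : topologicalType) (a : X -> Sinf -> X) (x0 : X)
    (Z : topologicalType) (b : Z -> Sinf -> Z) (z : Z) :
  greatest_ambit a x0 -> is_flow b ->
  exists f : X -> Z, continuous f /\ equivariant a b f /\ f x0 = z.
Proof.
move=> [_ univ] flowb.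
have [f [cf [ef fx]]] := univ _ _ _ (orbit_closure_ambit z flowb).
exists (set_val \o f); split; [|split].
- move=> x; apply: continuous_comp; first exact: cf.
  exact: initial_continuous.
- by move=> x g; rewrite /= ef.
- by rewrite /= fx.
Qed.

(** * The flow of 2-colourings of finite sequences *)

Definition coloring := {ptws seq nat -> bool}.

Definition coloring_act (c : coloring) (g : Sinf) : coloring :=
  fun s => c (map (sval g) s).

Lemma near_coloring (c : coloring) (s : seq nat) :
  \forall d \near c, d s = c s.
Proof.
have H : nbhs (c s) [set c s] by exact/principal_filterP.
exact: (@proj_continuous _ (fun _ : seq nat => bool) s c _ H).
Qed.

Lemma coloring_cvg (F : set_system coloring) (c : coloring) : Filter F ->
  (forall s, F [set d | d s = c s]) -> F --> c.
Proof.
move=> FF Fc; apply/cvg_sup => s U [V [[W] oW <-] Wc VU].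
apply: filterS (Fc s) => d dc; apply: VU => /=; rewrite dc; exact: Wc.
Qed.

Lemma coloring_flow : is_flow coloring_act.
Proof.
split; [|split; [|split; [split|]]].
- have := @tychonoff _ (fun _ : seq nat => bool) _ (fun=> bool_compact).
  by congr compact; apply/seteqP.
- by apply: hausdorff_product => s; exact: discrete_hausdorff.
- by move=> c; apply/funext => s; rewrite /coloring_act map_id.
- by move=> c g h; apply/funext => s; rewrite /coloring_act /= map_comp.
(* Joint continuity at [(c, g)] is the convergence of this filter to [coloring_act c g], which can
   be tested one sequence at a time. *)
- move=> c g; pose F : set_system coloring := [set W | exists V, nbhs c V /\
    exists F : seq nat, forall d h, V d ->
      (forall n, n \in F -> sval h n = sval g n) -> W (coloring_act d h)].
  suff : F --> coloring_act c g by [].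
  apply: coloring_cvg; first split.
  + by exists setT; split; [exact: filterT|exists [::]].
  + move=> P Q [V [cV [L VL]]] [V' [cV' [L' VL']]].
    exists (V `&` V'); split; first exact: filterI.
    exists (L ++ L') => d h [Vd V'd] hL; split.
      by apply: VL => // n nL; apply: hL; rewrite mem_cat nL.
    by apply: VL' => // n nL; apply: hL; rewrite mem_cat nL orbT.
  + move=> P Q PQ [V [cV [L VL]]]; exists V; split=> //; exists L => d h Vd hL.
    by apply: PQ; exact: VL.
  + move=> s; exists [set d | d (map (sval g) s) = c (map (sval g) s)].
    split; first exact: near_coloring.
    exists s => d h dc hg; rewrite /= /coloring_act -dc; congr (d _).
    exact/eq_in_map.
Qed.

Lemma Sinf_eq (g h : Sinf) : sval g =1 sval h -> g = h.
Proof.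
move=> gh; apply: eq_sig_hprop => [f p q|]; first exact: Prop_irrelevance.
exact/funext.
Qed.

Lemma Sinf_mul_invl (g h : Sinf) :
  exists k, h = Sinf_mul g k /\
    forall n, sval g n = sval h n -> sval k n = n.
Proof.
have [g' gK g'K] := svalP g.
have bg' : bijective g' by exists (sval g).
exists (exist _ _ (Sinf_comp_bij bg' (svalP h))); split=> [|n gh] /=.
  by apply: Sinf_eq => n /=; rewrite g'K.
by rewrite -gh gK.
Qed.

(** * Colourings separate the points of S(G) *)

Section ColoringMaps.
Context {X : topologicalType} (a : X -> Sinf -> X) (x0 : X).
Hypothesis gax0 : greatest_ambit a x0.

Definition coloring_map (c : coloring) : X -> coloring :=
  sval (cid (greatest_ambit_map c gax0 coloring_flow)).

Local Notation Phi := coloring_map.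

Let ambit0 : is_ambit a x0 := gax0.1.
Let cptX : compact [set: X] := ambit0.1.1.
Let hausX : hausdorff_space X := ambit0.1.2.1.
Let actX : right_action a := ambit0.1.2.2.1.
Let contX : action_continuous a := ambit0.1.2.2.2.

Lemma coloring_map_continuous (c : coloring) : continuous (Phi c).
Proof. by rewrite /Phi; case: cid => f [? []]. Qed.

Lemma coloring_map_equivariant (c : coloring) :
  equivariant a coloring_act (Phi c).
Proof. by rewrite /Phi; case: cid => f [? []]. Qed.

Lemma coloring_map0 (c : coloring) : Phi c x0 = c.
Proof. by rewrite /Phi; case: cid => f [? []]. Qed.

Lemma coloring_map_act (c : coloring) x g s :
  Phi c (a x g) s = Phi c x (map (sval g) s).
Proof. by rewrite coloring_map_equivariant. Qed.

Lemma coloring_map_orbit (c : coloring) g s :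
  Phi c (a x0 g) s = c (map (sval g) s).
Proof. by rewrite coloring_map_act coloring_map0. Qed.

Lemma near_coloring_map (c : coloring) (L : seq (seq nat)) (x : X) :
  \forall y \near x, forall s, s \in L -> Phi c y s = Phi c x s.
Proof.
elim: L => [|s L IH]; first by apply: filterE => y s; rewrite in_nil.
have Hs : \forall y \near x, Phi c y s = Phi c x s.
  exact: (coloring_map_continuous (near_coloring (Phi c x) s)).
apply: filterS2 Hs IH => y Hs HL t.
by rewrite inE => /predU1P[->|/HL].
Qed.

(** Density of the orbit of [x0]: any law on finitely many sequences that holds for all translates
    of [c] passes to [Phi c x]. *)
Lemma coloring_map_approx (c : coloring) (L : seq (seq nat)) (x : X) :
  exists g : Sinf, forall s, s \in L -> Phi c x s = c (map (sval g) s).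
Proof.
have [g Hg] := orbit_dense ambit0 (near_coloring_map c L x).
by exists g => s sL; rewrite -(Hg _ sL) coloring_map_orbit.
Qed.

(* Uniform continuity: near any closed set the action of the elements fixing
   [0, n) pointwise is uniformly small for n large, so a neighbourhood V of x
   is recovered, up to a slightly larger one, from the set of restrictions to
   [0, n) of the g with x0 g in V. *)
Lemma coloring_map_inj (x y : X) :
  (forall c n, Phi c x (iota 0 n) = Phi c y (iota 0 n)) -> x = y.
Proof.
move=> xy; apply: contrapT => /eqP nxy.
move: hausX; rewrite open_hausdorff => /(_ _ _ nxy)[[A B] /=].
rewrite !inE => -[Ax By] [oA oB /eqP AB0].
have nxA : nbhs x A by exact: open_nbhs_nbhs.
have nyB : nbhs y B by exact: open_nbhs_nbhs.
have [V xV VA] : filter_from (nbhs x) closure A.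
  by apply: (compact_regular hausX cptX _ nxA); exact: filterT.
have /compact_near_coveringP cov : compact (closure V).
  by apply: subclosed_compact cptX _ => //; exact: closed_closure.
have [|N _ HN] := cov nat \oo
    (fun n z => forall h, (forall i, i < n -> sval h i = i) -> A (a z h)) _.
  move=> z /VA Az.
  have nzA : nbhs (a z Sinf_one) A by rewrite actX.1; exact: open_nbhs_nbhs.
  have [U [zU [F UF]]] := contX nzA.
  exists (U, [set n | (\max_(i <- F) i < n)%N]).
    by split=> //=; exists (\max_(i <- F) i).+1.
  move=> [z' n] [/= Uz' Fn] h hn; apply: UF => // i iF.
  by apply: hn; apply: leq_ltn_trans Fn; exact: leq_bigmax_seq.
have {}HN z h : V z -> (forall i, i < N -> sval h i = i) -> A (a z h).
  by move=> /subset_closure Vz; exact: (HN N (leqnn N)).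
pose c : coloring := fun s =>
  `[< exists2 g, V (a x0 g) & map (sval g) (iota 0 N) = s >].
have cx : Phi c x (iota 0 N).
  have near1 := near_coloring_map c [:: iota 0 N] x.
  have [g [/= Vg Hg]] := orbit_dense ambit0 (filterI xV near1).
  rewrite -Hg ?inE// coloring_map_orbit; apply/asboolP; by exists g.
rewrite xy in cx.
have near2 := near_coloring_map c [:: iota 0 N] y.
have [g [/= Bg Hg]] := orbit_dense ambit0 (filterI nyB near2).
move: cx; rewrite -Hg ?inE// coloring_map_orbit => /asboolP[g' Vg' /eq_in_map gg'].
(* Since [g] and [g'] agree on [0, N), [g] is [g'] times an element fixing [0, N), which moves
   points of [V] only within [A]. *)
have [h [Eg hN]] := Sinf_mul_invl g' g.
suff : (A `&` B) (a x0 g) by move: AB0 => /eqP ->.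
split=> //; rewrite Eg -actX.2; apply: HN => // i iN; apply: hN.
by apply: gg'; rewrite mem_iota.
Qed.

Lemma lambda_map_exists (x : X) : exists f, lambda_map a x0 x f.
Proof. exact: greatest_ambit_map gax0 ambit0.1. Qed.

(** Both sides are continuous in [y] and agree on the orbit of [x0]. Multiplication by [x] on the
    left thus amounts to a change of colouring. *)
Lemma coloring_map_lambda (x : X) f (c : coloring) (y : X) :
  lambda_map a x0 x f -> Phi c (f y) = Phi (Phi c x) y.
Proof.
move=> [cf [ef fx]].
apply: (orbit_ext ambit0 (f := Phi c \o f) (f' := Phi (Phi c x))) y.
- exact: coloring_flow.2.1.
- move=> y; apply: continuous_comp; [exact: cf|exact: coloring_map_continuous].
- exact: coloring_map_continuous.
- move=> g /=; rewrite ef fx coloring_map_equivariant.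
  by rewrite coloring_map_equivariant coloring_map0.
Qed.

End ColoringMaps.

(** * Finite linear orders and rearrangements of tuples *)

Definition swap_nat (n k i : nat) : nat :=
  if i == n then k else if i == k then n else i.

Lemma swap_natK n k : involutive (swap_nat n k).
Proof.
move=> i; rewrite /swap_nat; case: (eqVneq i n) => [->|ni].
  by rewrite eqxx; case: eqVneq.
case: (eqVneq i k) => [->|ki]; first by rewrite eqxx.
by rewrite (negbTE ni) (negbTE ki).
Qed.

Lemma Sinf_extend (w : seq nat) :
  uniq w -> exists g : Sinf, map (sval g) (iota 0 (size w)) = w.
Proof.
elim/last_ind: w => [_|w b IH]; first by exists Sinf_one.
rewrite rcons_uniq => /andP[bw /IH[g gw]].
have [g' gK g'K] := svalP g.
(* After this transposition [g] sends [size w] to [b]. It fixes every [i < size w], because [b] is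
   not in [w] and so [g' b] is not below [size w]. *)
pose s := swap_nat (size w) (g' b).
have bs : bijective s by exists s; exact: swap_natK.
exists (Sinf_mul g (exist _ s bs)).
rewrite size_rcons -addn1 iotaD map_cat cats1 add0n; congr rcons; last first.
  by rewrite /= /s /swap_nat eqxx g'K.
rewrite -[RHS]gw; apply/eq_in_map => i; rewrite mem_iota /= add0n => iw.
rewrite /= /s /swap_nat (ltn_eqF iw); case: eqVneq => // ib.
by case/negP: bw; rewrite -gw; apply/mapP; exists i; rewrite ?mem_iota // ib g'K.
Qed.

Definition linear_order (R : rel nat) :=
  [/\ irreflexive R, transitive R & forall i j, i != j -> R i j || R j i].

Lemma linear_orderC R i j : linear_order R -> i != j -> R j i = ~~ R i j.
Proof.
move=> [irr tr tot] ij; have := tot i j ij.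
by case Rij: (R i j) => //=; case Rji: (R j i) => //; rewrite -(irr i) (tr j).
Qed.

Section OrdRank.
Variables (n : nat) (R : rel nat).
Hypothesis linR : linear_order R.

Definition ord_below (i : 'I_n) : {set 'I_n} := [set k : 'I_n | R k i].

Lemma ord_rank_subproof i : #|ord_below i| < n.
Proof.
have [irr _ _] := linR.
rewrite -[X in _ < X]card_ord -cardsT; apply: proper_card.
by rewrite properT; apply/eqP => /setP/(_ i); rewrite !inE irr.
Qed.

Definition ord_rank i : 'I_n := Ordinal (ord_rank_subproof i).

Lemma ord_rank_mono (i j : 'I_n) : R i j -> ord_rank i < ord_rank j.
Proof.
have [irr tr _] := linR => Rij; apply: proper_card; apply/properP; split.
  by apply/fintype.subsetP => k; rewrite !inE => /tr; exact.
by exists i; rewrite inE ?irr.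
Qed.

Lemma ord_rank_lt (i j : 'I_n) : (ord_rank i < ord_rank j) = R i j.
Proof.
have [irr tr tot] := linR.
apply/idP/idP => [ltij|]; last exact: ord_rank_mono.
have ij : val i != val j by apply: contraTN ltij => /eqP/val_inj ->; rewrite ltnn.
by case/orP: (tot _ _ ij) => // /ord_rank_mono /(ltn_trans ltij); rewrite ltnn.
Qed.

Lemma ord_rank_inj : injective ord_rank.
Proof.
move=> i j Eij; apply/val_inj/eqP; apply: contraT => ij.
have [_ _ tot] := linR; case/orP: (tot _ _ ij) => /ord_rank_mono;
by rewrite Eij ltnn.
Qed.

End OrdRank.

(** Match the elements of [0, n) that have equal rank in the two orders, then extend this finite
    injection to a permutation. *)
Lemma Sinf_order_match (R R' : rel nat) n :
  linear_order R -> linear_order R' ->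
  exists g : Sinf, forall i j, i < n -> j < n -> R' (sval g i) (sval g j) = R i j.
Proof.
move=> linR linR'.
pose t (i : 'I_n) := invF (@ord_rank_inj n _ linR') (ord_rank linR i).
have rt i : ord_rank linR' (t i) = ord_rank linR i by rewrite f_invF.
have tinj : injective t.
  by move=> i j /(congr1 (ord_rank linR')); rewrite !rt => /ord_rank_inj.
have [|g] := @Sinf_extend [seq val (t i) | i <- enum 'I_n].
  by rewrite map_inj_uniq ?enum_uniq // => i j /val_inj /tinj.
rewrite size_map -cardE card_ord -val_enum_ord -map_comp => /eq_in_map gt.
exists g => i j iln jln.
have gE k (kn : k < n) : sval g k = t (Ordinal kn).
  by rewrite -gt // mem_enum.
by rewrite (gE _ iln) (gE _ jln) -ord_rank_lt !rt ord_rank_lt.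
Qed.

Definition rank (R : rel nat) (s : seq nat) (x : nat) := count (R^~ x) s.

(* If s is listed in R-increasing order as s_0, ..., s_(n-1), this is the
   image of s under the map s_k |-> w_k. *)
Definition arrange (R : rel nat) (s w : seq nat) : seq nat :=
  [seq nth 0 w (rank R s x) | x <- s].

Lemma eq_in_arrange (R R' : rel nat) s w :
  {in s &, R =2 R'} -> arrange R s w = arrange R' s w.
Proof.
move=> RR'; apply/eq_in_map => x xs; congr nth.
by apply: eq_in_count => y ys; exact: RR'.
Qed.

Lemma arrange_map (R : rel nat) (f : nat -> nat) s w :
  arrange R (map f s) w = arrange (fun i j => R (f i) (f j)) s w.
Proof.
rewrite /arrange -map_comp; apply: eq_map => x /=.
by rewrite /rank count_map.
Qed.

Lemma arrange_pair (R : rel nat) i j w : linear_order R -> i != j ->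
  arrange R [:: i; j] w =
    if R i j then [:: nth 0 w 0; nth 0 w 1] else [:: nth 0 w 1; nth 0 w 0].
Proof.
move=> linR ij; have [irr _ _] := linR.
rewrite /arrange /rank /= !irr (linear_orderC linR ij).
by case: (R i j).
Qed.

(** The mask lists the values of [f] on [s] by increasing argument; the value at [k] stands at the
    position counting the elements of [s] below [k], where [arrange] looks for it. *)
Lemma arrange_ltn n s (f : nat -> nat) :
  {in s, forall x, x < n} -> uniq s ->
  arrange ltn s (mask [seq i \in s | i <- iota 0 n] (map f (iota 0 n))) = map f s.
Proof.
move=> sn us; apply/eq_in_map => k ks.
rewrite -map_mask -filter_mask.
have -> : iota 0 n = iota 0 k ++ k :: iota k.+1 (n - k.+1).
  have kn := sn _ ks.
  by rewrite -[k :: _]/(iota (0 + k) (n - k.+1).+1) -iotaD subnSK // subnKC // ltnW.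
rewrite filter_cat /= ks map_cat /=.
have -> : rank ltn s k = size (map f [seq i <- iota 0 k | i \in s]).
  rewrite size_map /rank -size_filter; apply/perm_size/uniq_perm.
  - exact: filter_uniq.
  - exact/filter_uniq/iota_uniq.
  - by move=> i; rewrite !mem_filter mem_iota /= add0n andbC.
by rewrite nth_cat ltnn subnn.
Qed.

Lemma count_mem_iota n s : {in s, forall x, x < n} -> uniq s ->
  count id [seq i \in s | i <- iota 0 n] = size s.
Proof.
move=> sn us; rewrite count_map -size_filter; apply/perm_size/uniq_perm => //.
- exact/filter_uniq/iota_uniq.
- move=> i; rewrite mem_filter mem_iota /= add0n.
  by case: (boolP (i \in s)) => //= /sn ->.
Qed.

(** * Coherent families of ultrafilters on increasing tuples *)

Lemma ultraC T (F : set_system T) (P : set T) :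
  UltraFilter F -> F (~` P) <-> ~ F P.
Proof.
move=> UF; split=> [FnP FP|nFP].
  by have [x []] := filter_ex (filterI FP FnP).
by have [] := in_ultra_setVsetC P UF.
Qed.

(* A coherent choice, for every n, of an ultrafilter on the increasing
   n-tuples: by tt_mask its image under passing to the k-subtuple at any k
   given positions is the ultrafilter on k-tuples. *)
Record tuple_type := TupleType {
  tt_ultra :> nat -> set_system (seq nat);
  tt_ultraP : forall n, UltraFilter (tt_ultra n);
  tt_sorted : forall n, tt_ultra n [set w | size w = n /\ sorted ltn w];
  tt_mask : forall m (P : set (seq nat)),
    tt_ultra (size m) [set w | P (mask m w)] <-> tt_ultra (count id m) P }.

#[export] Existing Instance tt_ultraP.

Lemma tt_take (T : tuple_type) n N (P : set (seq nat)) :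
  n <= N -> T n P -> T N [set w | P (take n w)].
Proof.
move=> nN; have := tt_mask T (nseq n true ++ nseq (N - n) false) P.
rewrite size_cat !size_nseq subnKC // count_cat !count_nseq /= mul1n mul0n addn0.
move=> H TP; have := (H.2 TP); apply: filterS2 (tt_sorted T N) => w [wN _] /=.
rewrite -{1}(cat_take_drop n w) mask_cat ?size_nseq ?size_take ?wN; last first.
  by move: nN; rewrite leq_eqVlt => /predU1P[->|->] //; rewrite ltnn.
rewrite mask_false cats0 mask_true // size_take wN.
by move: nN; rewrite leq_eqVlt => /predU1P[->|->] //; rewrite ltnn.
Qed.

Definition order_coloring : coloring :=
  fun s => if s is [:: i; j] then i < j else false.

Definition increasing_pairs (T : tuple_type) (d : coloring) : Prop :=
  T 2 [set w | d [:: nth 0 w 0; nth 0 w 1]].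

(** * The minimal subflow attached to a coherent family *)

Section MinimalFlows.
Context {X : topologicalType} (a : X -> Sinf -> X) (x0 : X).
Hypothesis gax0 : greatest_ambit a x0.

Local Notation Phi := (coloring_map gax0).

Let ambit0 : is_ambit a x0 := gax0.1.
Let cptX : compact [set: X] := ambit0.1.1.

(** This is the map from S(G) to the flow of linear orders; at [a x0 g] it gives the pullback of the
    usual order by [g]. *)
Definition point_order (x : X) : rel nat :=
  fun i j => Phi order_coloring x [:: i; j].

Lemma point_order_linear x : linear_order (point_order x).
Proof.
have app := coloring_map_approx gax0 order_coloring _ x.
split=> [i|j i k|i j ij]; rewrite /point_order.
- have [g ->] := app [:: [:: i; i]]; first by rewrite /= ltnn.
  by rewrite inE.
- have [g Hg] := app [:: [:: i; j]; [:: j; k]; [:: i; k]].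
  by rewrite !Hg ?inE ?eqxx ?orbT //=; exact: ltn_trans.
- have [g Hg] := app [:: [:: i; j]; [:: j; i]].
  rewrite !Hg ?inE ?eqxx ?orbT //= -neq_ltn (bij_eq (svalP g)).
  by [].
Qed.

Lemma point_order_act x g i j :
  point_order (a x g) i j = point_order x (sval g i) (sval g j).
Proof. by rewrite /point_order coloring_map_act. Qed.

Lemma near_point_order (s : seq nat) x :
  \forall y \near x, {in s &, point_order y =2 point_order x}.
Proof.
have := near_coloring_map gax0 order_coloring [seq [:: i; j] | i <- s, j <- s] x.
apply: filterS => y Hy i j si sj; apply: Hy.
exact: allpairs_f.
Qed.

(* The points x for which the pushforward of x to n-tuples is the ultrafilter
   T n, transported to the n-tuples ordered like (0, ..., n-1) by
   point_order x. *)
Definition typed_points (T : tuple_type) : set X :=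
  [set x | forall (c : coloring) s, uniq s ->
    (Phi c x s <-> T (size s) [set w | c (arrange (point_order x) s w)])].

Local Notation M := typed_points.

Lemma typed_points_closed T : closed (M T).
Proof.
move=> x clx c s us.
have [y [My [ys yo]]] := clx _ (filterI (near_coloring_map gax0 c [:: s] x)
  (near_point_order s x)).
rewrite -ys ?inE // (My c s us).
suff -> : arrange (point_order y) s = arrange (point_order x) s by [].
by apply/funext => w; exact: eq_in_arrange.
Qed.

Lemma typed_points_act T x g : M T x -> M T (a x g).
Proof.
move=> Mx c s us; rewrite coloring_map_act.
have injg : injective (sval g) by exact: bij_inj (svalP g).
rewrite (Mx c (map (sval g) s)) ?map_inj_uniq // size_map.
suff -> : arrange (point_order x) (map (sval g) s) =
  arrange (point_order (a x g)) s by [].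
apply/funext => w; rewrite arrange_map; apply: eq_in_arrange => i j _ _.
by rewrite point_order_act.
Qed.

(** [T] and the order of a point determine all its colours on tuples without repetition, and the
    colours on initial segments already determine the point. *)
Lemma typed_points_inj T x y :
  M T x -> M T y -> point_order x =2 point_order y -> x = y.
Proof.
move=> Mx My xy; apply: (coloring_map_inj (gax0 := gax0)) => c n; have un := iota_uniq 0 n.
have E : arrange (point_order x) (iota 0 n) = arrange (point_order y) (iota 0 n).
  by apply/funext => w; apply: eq_in_arrange => i j _ _.
by apply/idP/idP; rewrite (Mx _ _ un) (My _ _ un) E.
Qed.

Lemma typed_points_nonempty T : M T !=set0.
Proof.
(* The filter of the orbit points [a x0 g] for which the first values of [g] form a [T]-generic
   tuple; a cluster point of it is the desired point. *)
pose F : set_system X := [set A | exists n, T n [set w |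
  forall g : Sinf, map (sval g) (iota 0 n) = w -> A (a x0 g)]].
have PF : ProperFilter F.
  split.
    move=> [n Tn]; have [w [Hw [nw sw]]] := filter_ex (filterI Tn (tt_sorted T n)).
    have [g gw] := Sinf_extend (sorted_uniq ltn_trans ltnn sw).
    by apply: (Hw g); rewrite -nw.
  split.
  - by exists 0; apply: filterE => w g.
  - move=> P Q [n Pn] [m Qm]; exists (n + m).
    have Tn := tt_take (leq_addr m n) Pn.
    have Tm := tt_take (leq_addl n m) Qm.
    apply: filterS2 Tn Tm => w Pw Qw g gw; split.
      by apply: Pw; rewrite -gw -map_take take_iota (minn_idPl _) ?leq_addr.
    by apply: Qw; rewrite -gw -map_take take_iota (minn_idPl _) ?leq_addl.
  - move=> P Q PQ [n Pn]; exists n; apply: filterS Pn => w Hw g gw.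
    by apply: PQ; exact: Hw.
have [|x [_ clx]] := cptX PF; first exact: filterT.
(* A colour is locally constant in the point, so one that holds along [F] holds at the cluster
   point. *)
have Fx (c : coloring) s b : F [set z | Phi c z s = b] -> Phi c x s = b.
  move=> Fb; have [z [/= zb zs]] := clx _ _ Fb (near_coloring_map gax0 c [:: s] x).
  by rewrite -zs ?inE.
(* Generic tuples are increasing, so the cluster point carries the usual order. *)
have ordx i j : point_order x i j = (i < j).
  apply: Fx; exists (maxn i j).+1.
  apply: filterS (tt_sorted T _) => w [sz sw] g gw /=.
  rewrite coloring_map_orbit /=.
  have gE k : k < (maxn i j).+1 -> sval g k = nth 0 w k.
    by move=> kn; rewrite -gw (nth_map 0) ?size_iota // nth_iota.
  rewrite !gE ?ltnS ?leq_maxl ?leq_maxr //.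
  have mono := sorted_ltn_nth ltn_trans 0 sw.
  case: (ltngtP i j) => [ij|ji|->]; last exact: ltnn.
    by apply: mono; rewrite ?inE ?sz ?ltnS ?leq_maxl ?leq_maxr.
  by apply/negbTE; rewrite -leqNgt ltnW // mono // inE sz ltnS ?leq_maxl ?leq_maxr.
exists x => c s us.
suff -> : Phi c x s = `[< T (size s) [set w | c (arrange (point_order x) s w)] >].
  by split=> [/asboolP|?]; last exact/asboolP.
(* [n] exceeds all entries of [s], so the colour of [s] depends only on the first [n] values of [g],
   and [tt_mask] reduces it to a tuple of length [size s]. *)
apply: Fx; pose n := (\max_(i <- s) i).+1; exists n.
have sn : {in s, forall i, i < n} by move=> i si; rewrite ltnS leq_bigmax_seq.
pose m := [seq i \in s | i <- iota 0 n].
have Tm (P : set (seq nat)) : T n [set w | P (mask m w)] <-> T (size s) P.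
  by have := tt_mask T m P; rewrite size_map size_iota count_mem_iota.
have arr w (g : Sinf) : map (sval g) (iota 0 n) = w ->
    arrange (point_order x) s (mask m w) = map (sval g) s.
  move=> <-; rewrite -(arrange_ltn (sval g) sn us).
  by apply: eq_in_arrange => i j _ _; rewrite ordx.
case: (pselect (T (size s) [set w | c (arrange (point_order x) s w)])) => Tc.
  rewrite (asboolT Tc); apply: filterS ((Tm _).2 Tc) => w cw g gw /=.
  by rewrite coloring_map_orbit -(arr w).
rewrite (asboolF Tc); move: Tc; rewrite -ultraC => /Tm.
apply: filterS => w /= cw g gw; rewrite coloring_map_orbit -(arr w g gw).
exact/negbTE/negP.
Qed.

Lemma typed_points_subflow T : subflow a (M T).
Proof.
split; first exact: typed_points_nonempty.
by split; [exact: typed_points_closed|exact: typed_points_act].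
Qed.

(** Translates of any point [y] realize the order of [x] on each [0, n). By compactness a subflow
    contains a point with exactly the order of [x], and that point is [x]. *)
Lemma typed_points_minimal T : minimal_subflow a (M T).
Proof.
split; first exact: typed_points_subflow.
move=> M' [[y M'y] [clM' M'act]] M'M; apply/seteqP; split=> // x Mx.
pose C n := [set z | M' z /\
  {in iota 0 n &, point_order z =2 point_order x}].
have PF : ProperFilter (filter_from setT C).
  apply: filter_from_proper => [|n _].
    apply: filter_from_filter; first by exists 0.
    move=> i j _ _; exists (maxn i j) => // z [M'z zx].
    split; split=> // k l; rewrite !mem_iota /= !add0n => ki li.
      by apply: zx; rewrite mem_iota /= add0n leq_max ?ki ?li.
    by apply: zx; rewrite mem_iota /= add0n leq_max ?ki ?li orbT.
  have [g Hg] := Sinf_order_match n (point_order_linear x) (point_order_linear y).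
  exists (a y g); split; first exact: M'act.
  by move=> i j; rewrite !mem_iota /= point_order_act; exact: Hg.
have cM' : compact M' by exact: subclosed_compact clM' cptX _.
have [|z [M'z clz]] := cM' _ PF; first by exists 0 => // z [].
suff -> : x = z by [].
apply: (typed_points_inj Mx (M'M _ M'z)) => i j.
have FC : filter_from setT C (C (maxn i j).+1) by exists (maxn i j).+1.
have [t [[_ tx] tz]] := clz _ _ FC (near_point_order [:: i; j] z).
rewrite -tz ?inE ?eqxx ?orbT // tx // mem_iota /= add0n ltnS ?leq_maxl //.
by rewrite leq_maxr.
Qed.

(** [arrange] keeps or reverses the generic pair according to the order of [x], and reversing a pair
    negates [d] because [d] is a linear order. *)
Lemma coloring_map_pair T x (d : coloring) i j :
  M T x -> linear_order (fun i j => d [:: i; j]) -> i != j ->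
  Phi d x [:: i; j] <-> (point_order x i j <-> increasing_pairs T d).
Proof.
move=> Mx lind ij; rewrite Mx /=; last by rewrite inE ij.
rewrite /increasing_pairs.
under eq_fun => w do rewrite (arrange_pair _ (point_order_linear x) ij).
case: (point_order x i j); first by split=> [?|[H _]]; [split|exact: H].
have -> : T 2 [set w | d [:: nth 0 w 1; nth 0 w 0]] <->
          ~ T 2 [set w | d [:: nth 0 w 0; nth 0 w 1]].
  rewrite -ultraC; split; apply: filterS2 (tt_sorted T 2) => w [];
    case: w => [|p [|q []]] //= _; rewrite andbT => /ltn_eqF/negbT pq;
    have -> : d [:: q; p] = ~~ d [:: p; q] by exact: (linear_orderC lind pq).
    by move=> /negP.
  by move=> /negP.
by split=> [?|[_ H /H]]; [split|].
Qed.

End MinimalFlows.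

(** * Products and idempotents in the minimal subflows *)

Definition same_pair_type (T T' : tuple_type) :=
  forall d : coloring, linear_order (fun i j => d [:: i; j]) ->
    increasing_pairs T d <-> increasing_pairs T' d.

Section Idempotents.
Context {X : topologicalType} (a : X -> Sinf -> X) (x0 : X).
Hypothesis gax0 : greatest_ambit a x0.

Local Notation Phi := (coloring_map gax0).
Local Notation M := (typed_points gax0).
Local Notation J T := (idempotents a x0 (M T)).

Lemma point_order_lambda T u v f i j :
  M T v -> lambda_map a x0 u f -> i != j ->
  point_order gax0 (f v) i j <->
    (point_order gax0 v i j <-> increasing_pairs T (Phi order_coloring u)).
Proof.
move=> Mv lf ij; rewrite {1}/point_order (coloring_map_lambda gax0 _ _ lf).
exact: coloring_map_pair Mv (point_order_linear gax0 u) ij.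
Qed.

Lemma point_order_lambda_eq T u v f :
  M T v -> lambda_map a x0 u f -> increasing_pairs T (Phi order_coloring u) ->
  point_order gax0 (f v) =2 point_order gax0 v.
Proof.
move=> Mv lf pu i j; have [->|ij] := eqVneq i j.
  have [irr _ _] := point_order_linear gax0 (f v).
  by have [irr' _ _] := point_order_linear gax0 v; rewrite irr irr'.
have [H1 H2] := point_order_lambda Mv lf ij.
by apply/idP/idP => [/H1[_]|H]; [exact|apply: H2; split].
Qed.

(** A subflow is a right ideal: [f] sends the orbit of [x0] to the orbit of [u], hence all of S(G)
    into the closed set [M T]. *)
Lemma typed_points_lambda T u v f :
  M T u -> lambda_map a x0 u f -> M T (f v).
Proof.
move=> Mu [cf [ef fx]]; suff : (f @^-1` M T) v by [].
apply: (orbit_closed gax0.1) v.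
  apply: closed_comp; last exact: typed_points_closed.
  by move=> y _; exact: cf.
by move=> g /=; rewrite ef fx; exact: typed_points_act.
Qed.

(** If generic pairs were decreasing, the product of [u] with itself would carry the reverse of the
    order of [u]; the pair 0, 1 detects this. Otherwise both points of [M T] have the same order,
    hence coincide. *)
Lemma lambda_fixed_increasing T u f : M T u -> lambda_map a x0 u f ->
  f u = u <-> increasing_pairs T (Phi order_coloring u).
Proof.
move=> Mu lf; split=> [fu|pu].
  have [] := @point_order_lambda T u u f 0 1 Mu lf isT; rewrite fu.
  case: (point_order gax0 u 0 1) => [/(_ isT)[+ _] _|_ H]; first exact.
  by apply: contrapT => nP; have : false by apply: H; split.
apply: (typed_points_inj (typed_points_lambda u Mu lf) Mu).
exact: point_order_lambda_eq Mu lf pu.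
Qed.

(** Agreement on pairs is used twice: for [u], from [T] to [T'], so that the product has the order
    of [v]; then for [v], from [T'] to [T], so that the product, a point of [M T], is idempotent. *)
Lemma idempotents_mul T T' u v : same_pair_type T T' -> J T u -> J T' v ->
  exists z, J T z /\ sg_prod a x0 u v z.
Proof.
move=> TT' [Mu [f [lf fu]]] [Mv [f' [lf' fv]]].
have pu : increasing_pairs T' (Phi order_coloring u).
  apply/TT'; first exact: point_order_linear.
  exact/(lambda_fixed_increasing Mu lf).
have ov := point_order_lambda_eq Mv lf pu.
have Mfv := typed_points_lambda v Mu lf.
exists (f v); split; last by exists f.
split=> //; have [h lh] := lambda_map_exists gax0 (f v).
exists h; split=> //; apply/(lambda_fixed_increasing Mfv lh).
have -> : increasing_pairs T (Phi order_coloring (f v)) =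
          increasing_pairs T (Phi order_coloring v).
  by congr (tt_ultra T 2 _); apply/funext => w; rewrite /= -!/(point_order _ _ _ _) ov.
apply/TT'; first exact: point_order_linear.
exact/(lambda_fixed_increasing Mv lf').
Qed.

Lemma idempotents_subsemigroup T T' : same_pair_type T T' ->
  subsemigroup a x0 (J T `|` J T').
Proof.
move=> TT'; have T'T : same_pair_type T' T.
  by move=> d lind; split=> /(TT' d lind).
have refl T1 : same_pair_type T1 T1 by [].
move=> u v [Ju|Ju] [Jv|Jv].
- by have [z [Jz ?]] := idempotents_mul (refl T) Ju Jv; exists z; split; [left|].
- by have [z [Jz ?]] := idempotents_mul TT' Ju Jv; exists z; split; [left|].
- by have [z [Jz ?]] := idempotents_mul T'T Ju Jv; exists z; split; [right|].
- by have [z [Jz ?]] := idempotents_mul (refl T') Ju Jv; exists z; split; [right|].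
Qed.

End Idempotents.

(** * Limits of ultrafilters and Fubini powers *)

Lemma ultra_of_decides T (F : set_system T) : ProperFilter F ->
  (forall P, F P \/ F (~` P)) -> UltraFilter F.
Proof.
move=> PF dec; split=> // G PG FG; apply/seteqP; split=> [P GP|]; last exact: FG.
have [//|/FG GnP] := dec P.
by have [x []] := filter_ex (filterI GP GnP).
Qed.

Lemma proper_const T (F : set_system T) (P : Prop) :
  ProperFilter F -> F [set _ | P] <-> P.
Proof.
by move=> PF; split=> [/filter_ex[]//|p]; exact: filterE.
Qed.

Definition ultra_bind S T (F : set_system S) (k : S -> set_system T) :
  set_system T := [set P | F [set x | k x P]].

Lemma eq_ultra_bind S S' T (F : set_system S') (k : S' -> set_system S)
    (k' : S' -> set_system T) P P' :
  (forall x, k x P <-> k' x P') -> ultra_bind F k P <-> ultra_bind F k' P'.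
Proof.
move=> kk'; rewrite /ultra_bind /=.
by have -> : [set x | k x P] = [set x | k' x P'] by apply/seteqP; split=> x /kk'.
Qed.

Lemma ultra_bindP S T (F : set_system S) (k : S -> set_system T) :
  UltraFilter F -> (forall x, UltraFilter (k x)) -> UltraFilter (ultra_bind F k).
Proof.
move=> UF Uk; apply: ultra_of_decides.
  split.
    by move=> F0; have [x k0] := filter_ex (F0 : F _); have [] := filter_ex k0.
  split.
  - by apply: (@filterE _ F) => x; exact: filterT.
  - by move=> P Q; apply: (@filterS2 _ F) => x; exact: filterI.
  - by move=> P Q PQ; apply: (@filterS _ F) => x; exact: filterS.
move=> P; have [FP|] := in_ultra_setVsetC [set x | k x P] UF; first by left.
by move=> FnP; right; apply: (@filterS _ F) FnP => x /=; rewrite ultraC.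
Qed.

Lemma ultra_fmap S T (F : set_system S) (f : S -> T) :
  UltraFilter F -> UltraFilter (f @ F).
Proof.
move=> UF; apply: ultra_of_decides => P.
exact: in_ultra_setVsetC (f @^-1` P) UF.
Qed.

Fixpoint fubini_power (U : set_system nat) (n : nat) : set_system (seq nat) :=
  if n is n'.+1 then ultra_bind U (fun i => cons i @ fubini_power U n')
  else [set P | P [::]].

Section FubiniPower.
Variable U : set_system nat.
Hypotheses (UU : UltraFilter U) (freeU : forall n, U [set i | n < i]).

Lemma fubini_powerP n : UltraFilter (fubini_power U n).
Proof.
elim: n => [|n IH] /=; last by apply: ultra_bindP => i; exact: ultra_fmap.
apply: ultra_of_decides => [|P]; last exact: EM.
by split=> //; split=> // P Q PQ; exact: PQ.
Qed.

#[local] Existing Instance fubini_powerP.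

Lemma fubini_power_sorted n :
  fubini_power U n [set w | size w = n /\ sorted ltn w].
Proof.
(* The induction needs a lower bound [k] for the first entry; freeness of [U] supplies it. *)
suff path_n k : fubini_power U n [set w | size w = n /\ path ltn k w].
  apply: (@filterS _ (fubini_power U n)) (path_n 0) => w [sw /path_sorted].
  by split.
elim: n k => [//|n IH] k.
apply: (@filterS _ U) (freeU k) => i ki.
apply: (@filterS _ (fubini_power U n)) (IH i) => w [sw pw] /=.
by rewrite sw ki.
Qed.

Lemma fubini_power_mask m (P : set (seq nat)) :
  fubini_power U (size m) [set w | P (mask m w)] <->
  fubini_power U (count id m) P.
Proof.
elim: m P => [//|[] m IH] P /=.
  by apply: eq_ultra_bind => i; exact: (IH [set w | P (i :: w)]).
(* A dropped coordinate is quantified vacuously. *)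
by rewrite add0n -IH; exact: proper_const.
Qed.

Definition fubini_type : tuple_type :=
  TupleType fubini_powerP fubini_power_sorted fubini_power_mask.

End FubiniPower.

#[local] Existing Instance fubini_powerP.

(** * Two coherent families built from coded pairs *)

Definition pair_code (a b : nat) : nat := CodeSeq.code [:: a; b].

Lemma pair_code_mono a b a' b' :
  a < a' -> b < b' -> pair_code a b < pair_code a' b'.
Proof.
by move=> aa' bb'; rewrite /pair_code /= !muln1 ltn_mul ?ltnS ?ltn_double ?ltn_exp2l.
Qed.

Definition zip_code (v w : seq nat) : seq nat :=
  [seq pair_code p.1 p.2 | p <- zip v w].

Lemma zip_code_sorted v w :
  size v = size w -> sorted ltn v -> sorted ltn w -> sorted ltn (zip_code v w).
Proof.
case: v w => [|a v] [|b w] //= [].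
elim: v w a b => [|a' v IH] [|b' w] //= a b [svw] /andP[aa' pv] /andP[bb' pw].
by rewrite pair_code_mono //=; exact: IH.
Qed.

Lemma mask_zip_code m v w :
  mask m (zip_code v w) = zip_code (mask m v) (mask m w).
Proof.
rewrite /zip_code -map_mask; congr map.
by elim: m v w => [|[] m IH] [|a v] [|b w] //=; rewrite ?IH //; case: (mask m _).
Qed.

Section Types.
Variable U : set_system nat.
Hypotheses (UU : UltraFilter U) (freeU : forall n, U [set i | n < i]).

Definition square_ultra : set_system nat :=
  ultra_bind U (fun i => pair_code i @ U).

Lemma square_ultraP : UltraFilter square_ultra.
Proof. by apply: ultra_bindP => i; exact: ultra_fmap. Qed.

Lemma square_ultra_free n : square_ultra [set i | n < i].
Proof.
apply: (@filterS _ U) (freeU n) => i ni; apply: (@filterE _ U) => j /=.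
apply: leq_trans (leq_pmulr _ _) => //.
by apply: ltn_trans ni _; exact: ltn_expl.
Qed.

(* Generic tuples of pairs (a_1, b_1), ..., (a_n, b_n) with
   a_1 < b_1 < a_2 < b_2 < ... < a_n < b_n. *)
Definition consecutive_type : tuple_type :=
  fubini_type square_ultraP square_ultra_free.

Definition split_power n : set_system (seq nat) :=
  ultra_bind (fubini_power U n) (fun v => zip_code v @ fubini_power U n).

Lemma split_powerP n : UltraFilter (split_power n).
Proof. by apply: ultra_bindP => v; exact: ultra_fmap. Qed.

Lemma split_power_sorted n :
  split_power n [set w | size w = n /\ sorted ltn w].
Proof.
have H := fubini_power_sorted UU freeU n.
apply: (@filterS _ (fubini_power U n)) (H) => v [sv ov].
apply: (@filterS _ (fubini_power U n)) (H) => w [sw ow] /=.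
split; first by rewrite size_map size_zip sv sw minnn.
by apply: zip_code_sorted; rewrite ?sv.
Qed.

Lemma split_power_mask m (P : set (seq nat)) :
  split_power (size m) [set w | P (mask m w)] <-> split_power (count id m) P.
Proof.
(* The two factors are masked one at a time; here the second is already shortened. *)
transitivity (ultra_bind (fubini_power U (size m))
  (fun v => zip_code (mask m v) @ fubini_power U (count id m)) P); last first.
  exact: (fubini_power_mask UU m
    [set v | (zip_code v @ fubini_power U (count id m)) P]).
apply: eq_ultra_bind => v.
have := fubini_power_mask UU m (zip_code (mask m v) @^-1` P).
suff -> : [set w | (zip_code (mask m v) @^-1` P) (mask m w)] =
  zip_code v @^-1` [set w | P (mask m w)] by [].
by apply/funext => w; rewrite /preimage /= mask_zip_code.
Qed.

(* Generic tuples of pairs (a_1, b_1), ..., (a_n, b_n) with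
   a_1 < ... < a_n < b_1 < ... < b_n. *)
Definition split_type : tuple_type :=
  TupleType split_powerP split_power_sorted split_power_mask.

(* For generic 0 < 1 < ... < 5, the pairs (0,2), (1,4), (3,5) are pairwise of
   split type, except that (0,2), (3,5) is of consecutive type: a transitive
   relation cannot orient the two types in opposite ways. *)
Lemma fubini_power_no_cycle (R : rel nat) : irreflexive R -> transitive R ->
  fubini_power U 4 [set w | R (pair_code (nth 0 w 0) (nth 0 w 1))
                              (pair_code (nth 0 w 2) (nth 0 w 3))] ->
  fubini_power U 4 [set w | R (pair_code (nth 0 w 1) (nth 0 w 3))
                              (pair_code (nth 0 w 0) (nth 0 w 2))] -> False.
Proof.
move=> irr tr cons split.
have PF : ProperFilter (fubini_power U 6) by exact: ultra_proper.
(* The masks select positions 0,1,2,4, then 1,3,4,5, then 0,2,3,5. The resulting cycle is (0,2) R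
   (3,5) R (1,4) R (0,2). *)
have H1 : fubini_power U 6 _ := (fubini_power_mask UU [:: true; true; true; false; true; false] _).2 split.
have H2 : fubini_power U 6 _ := (fubini_power_mask UU [:: false; true; false; true; true; true] _).2 split.
have H3 : fubini_power U 6 _ := (fubini_power_mask UU [:: true; false; true; true; false; true] _).2 cons.
have Hs := fubini_power_sorted UU freeU 6.
have [z [[R1 R2] [R3 [sz _]]]] := filter_ex (filterI (filterI H1 H2) (filterI H3 Hs)).
case: z sz R1 R2 R3 => [|z0 [|z1 [|z2 [|z3 [|z4 [|z5 []]]]]]] //= _ R1 R2 R3.
by have := tr _ _ _ R3 (tr _ _ _ R2 R1); rewrite irr.
Qed.

Lemma consecutive_split_same_pair_type :
  same_pair_type consecutive_type split_type.
Proof.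
move=> d lind; have [irr tr _] := lind.
have flip T : ~ increasing_pairs T d -> T 2 [set w | d [:: nth 0 w 1; nth 0 w 0]].
  rewrite -ultraC; apply: filterS2 (tt_sorted T 2) => w [].
  case: w => [|p [|q []]] //= _; rewrite andbT => /ltn_eqF/negbT pq.
  by move=> /negP; rewrite -(linear_orderC lind pq).
split=> H; apply: contrapT => /flip H'.
  (* Both families at length 2 unfold to four nested [U]-quantifiers, so [H] and [H'] are statements
     about [fubini_power U 4] by conversion. *)
  exact: (fubini_power_no_cycle irr tr H H').
apply: (@fubini_power_no_cycle (fun i j => d [:: j; i])) H' H => //.
by move=> j i k ji kj; exact: tr kj ji.
Qed.

(** The colouring that tells the two families apart. It is symmetric in the two pairs, so the order
    of a point does not affect it. *)
Definition disjoint_spans : coloring := fun s =>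
  let p := CodeSeq.decode (nth 0 s 0) in let q := CodeSeq.decode (nth 0 s 1) in
  (nth 0 p 1 < nth 0 q 0) || (nth 0 q 1 < nth 0 p 0).

Lemma disjoint_spansE a b a' b' :
  disjoint_spans [:: pair_code a b; pair_code a' b'] = (b < a') || (b' < a).
Proof. by rewrite /disjoint_spans /= !CodeSeq.codeK. Qed.

Lemma consecutive_disjoint_spans : increasing_pairs consecutive_type disjoint_spans.
Proof.
have : fubini_power U 4 [set w | disjoint_spans
    [:: pair_code (nth 0 w 0) (nth 0 w 1); pair_code (nth 0 w 2) (nth 0 w 3)]].
  apply: filterS (fubini_power_sorted UU freeU 4) => w [].
  case: w => [|a [|b [|c [|e []]]]] //= _ /and4P[_ bc _ _].
  by rewrite disjoint_spansE bc.
exact.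
Qed.

Lemma split_disjoint_spans : ~ increasing_pairs split_type disjoint_spans.
Proof.
suff : fubini_power U 4 (~` [set w | disjoint_spans
    [:: pair_code (nth 0 w 0) (nth 0 w 2); pair_code (nth 0 w 1) (nth 0 w 3)]]).
  by rewrite ultraC.
apply: filterS (fubini_power_sorted UU freeU 4) => w [].
case: w => [|a [|b [|c [|e []]]]] //= _ /and4P[ab bc ce _].
rewrite disjoint_spansE => /orP[cb|ea].
  by have := ltn_trans bc cb; rewrite ltnn.
by have := ltn_trans (ltn_trans ab bc) (ltn_trans ce ea); rewrite ltnn.
Qed.

End Types.

(** * The two subflows are distinct *)

Lemma typed_points_increasing_pairs (X : topologicalType) (a : X -> Sinf -> X)
    (x0 x : X) (gax0 : greatest_ambit a x0) (T : tuple_type) (c : coloring) :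
  (forall i j, c [:: i; j] = c [:: j; i]) -> typed_points gax0 T x ->
  coloring_map gax0 c x [:: 0; 1] <-> increasing_pairs T c.
Proof.
move=> csym Mx; rewrite (Mx c [:: 0; 1] isT) /=.
under eq_fun => w do rewrite (arrange_pair _ (point_order_linear gax0 x)) //.
by case: point_order => //; under eq_fun => w do rewrite csym.
Qed.

Lemma free_ultrafilter_nat :
  exists U : set_system nat, UltraFilter U /\ forall n, U [set i | n < i].
Proof.
have [U [UU sU]] := ultraFilterLemma (_ : ProperFilter \oo).
by exists U; split=> // n; apply: sU; exists n.+1.
Qed.

Theorem mainTheorem3 (X : topologicalType) (a : X -> Sinf -> X) (x0 : X) :
  greatest_ambit a x0 ->
  exists M N : set X,
    minimal_subflow a M /\ minimal_subflow a N /\ M <> N /\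
    subsemigroup a x0 (idempotents a x0 M `|` idempotents a x0 N).
Proof.
move=> gax0; have [U [UU freeU]] := free_ultrafilter_nat.
pose T := consecutive_type UU freeU; pose T' := split_type UU freeU.
exists (typed_points gax0 T), (typed_points gax0 T').
split; first exact: typed_points_minimal.
split; first exact: typed_points_minimal.
split; last exact/idempotents_subsemigroup/consecutive_split_same_pair_type.
move=> MM'; have [x Mx] := typed_points_nonempty gax0 T.
have M'x : typed_points gax0 T' x by rewrite -MM'.
have csym i j : disjoint_spans [:: i; j] = disjoint_spans [:: j; i].
  by rewrite /disjoint_spans /= orbC.
(* A common point [x] would transfer [disjoint_spans] from consecutive generic pairs to split
   ones. *)
apply: (@split_disjoint_spans U UU freeU).
apply/(typed_points_increasing_pairs csym M'x).
apply/(typed_points_increasing_pairs csym Mx).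
exact: consecutive_disjoint_spans.
Qed.
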